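(* Let $r$ and $k$ be nonnegative integers. Then $$\binom{r+\frac12}{k+1} = \frac{(-1)^{k+r}(2r+1)(r+1)!}{2^{2k+r+1}\prod_{j=1}^{r}\bigl(2(k-j)+1\bigr)}\,C_kC_r.$$ In particular, for $k\ge r\ge 0$, $$\binom{r+\frac12}{k+1} = (-1)^{k+r}\,\frac{2r+1}{2^{2k+1}}\,\frac{\binom{k}{r}}{\binom{2k}{2r}}\,C_k.$$
   Context: $C_n=\frac{1}{n+1}\binom{2n}{n}$, $n\ge 0$, are the Catalan numbers. For complex $x$ and nonnegative integer $k$, $\binom{x}{k}=\frac{x(x-1)\cdots(x-k+1)}{k!}$ is the generalized binomial coefficient. Empty products equal $1$. *)

(* Defs.v *)
From mathcomp Require Import all_boot all_order all_algebra.

Set Implicit Arguments.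
Unset Strict Implicit.
Unset Printing Implicit Defensive.

Import GRing.Theory Num.Theory.
Local Open Scope ring_scope.

(* Everything lives in an arbitrary numFieldType, of which the complex
   numbers are an instance; such a field has characteristic 0, so the
   factorials and integers inverted below are nonzero. *)

(* Generalized binomial coefficient x (x - 1) ... (x - k + 1) / k`!. *)
Definition gbinom (F : numFieldType) (x : F) (k : nat) : F :=
  (\prod_(0 <= i < k) (x - i%:R)) / k`!%:R.

(* Catalan numbers, valued in F so that the division is exact. *)
Definition catalan (F : numFieldType) (n : nat) : F :=
  1 / (n + 1)%:R * 'C(2 * n, n)%:R.

(* Main.v *)
(* Both formulas follow by induction on r, since their right-hand sides and
   the left-hand side all obey, with x = r + 1/2, the recurrence
   (x - k) binom(x + 1, k + 1) = (x + 1) binom(x, k + 1).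
   As x is a half-integer, x - k is never zero. The base case
   binom(1/2, k + 1) = (-1)^k C_k / 2^(2k + 1) is an induction on k. *)
Require Import Defs.
From mathcomp Require Import all_boot all_order all_algebra.
From mathcomp Require Import zify ring.

Set Implicit Arguments.
Unset Strict Implicit.
Unset Printing Implicit Defensive.

Import GRing.Theory Num.Theory.
Local Open Scope ring_scope.

Lemma gbinomS (F : numFieldType) (x : F) (k : nat) :
  gbinom x k.+1 = gbinom x k * (x - k%:R) / k.+1%:R.
Proof. by rewrite /gbinom big_nat_recr //= factS natrM invfM; ring. Qed.

Lemma gbinom_shift (F : numFieldType) (x : F) (k : nat) :
  (x - k%:R) * gbinom (x + 1) k.+1 = (x + 1) * gbinom x k.+1.
Proof.
rewrite /gbinom big_nat_recl // big_nat_recr //= subr0.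
under eq_bigr => i _ do rewrite -natr1 opprD addrACA subrr addr0.
by ring.
Qed.

Lemma central_binS (n : nat) :
  (n.+1 * 'C(2 * n.+1, n.+1) = 2 * (2 * n + 1) * 'C(2 * n, n))%N.
Proof.
(* The two absorption identities meet at ['C(2 * n + 1, n)]. *)
have := mul_bin_diag (2 * n.+1) n; have := mul_bin_down (2 * n).+1 n.
rewrite mulnS /= (_ : (2 * n).+1 - n = n.+1)%N; last lia.
by move: 'C(_, _) 'C(_, _) 'C(_, _) => a b c; lia.
Qed.

Lemma catalanS (F : numFieldType) (n : nat) :
  catalan F n.+1 = 2 * (2 * n%:R + 1) / n.+2%:R * catalan F n.
Proof.
have h : n.+1%:R * 'C(2 * n.+1, n.+1)%:R =
    2 * (2 * n%:R + 1) * 'C(2 * n, n)%:R :> F.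
  by rewrite -natrM central_binS !natrM natrD natrM.
have n1 : (n.+1%:R : F) != 0 by rewrite pnatr_eq0.
rewrite /catalan !addn1 -(mulKf n1 'C(2 * n.+1, n.+1)%:R) h.
by rewrite !div1r; ring.
Qed.

(** Parity separates [2 * k + 1] from [2 * j]. The subtraction is in [F], so [j] may exceed [k]. *)
Lemma odd_natr_neq0 (F : numFieldType) (k j : nat) :
  2 * (k%:R - j%:R) + 1 != 0 :> F.
Proof.
rewrite (_ : _ + 1 = (2 * k + 1)%:R - (2 * j)%:R); last first.
  by rewrite natrD !natrM; ring.
by rewrite subr_eq0 eqr_nat; lia.
Qed.

(** Cleared of denominators, this is the ratio of consecutive values in [r] of
    ['C(k, r) / 'C(2 * k, 2 * r)]. *)
Lemma mul_bin_doubleS (k r : nat) : (r < k)%N ->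
  ((2 * (k - r.+1) + 1) * ('C(k, r.+1) * 'C(2 * k, 2 * r)) =
   (2 * r + 1) * ('C(k, r) * 'C(2 * k, 2 * r.+1)))%N.
Proof.
move=> /subnK <-; move: (k - r.+1)%N => m; rewrite addnK.
have := mul_bin_left (2 * (m + r.+1)) (2 * r).+1.
have := mul_bin_left (2 * (m + r.+1)) (2 * r).
have := mul_bin_left (m + r.+1) r.
rewrite (_ : (2 * r).+2 = 2 * r.+1)%N; last lia.
rewrite (_ : m + r.+1 - r = m.+1)%N; last lia.
rewrite (_ : 2 * (m + r.+1) - 2 * r = 2 * m.+1)%N; last lia.
rewrite (_ : 2 * (m + r.+1) - (2 * r).+1 = 2 * m + 1)%N; last lia.
move: 'C(_, _) => c1; move: 'C(_, _) => c0; move: 'C(_, _) => d1.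
move: 'C(_, _) => d0; move: 'C(_, _) => d2 => hc hd1 hd2.
(* The factor [r.+1] lets [hc] eliminate [c1]; the multipliers below make the goal linear in the
   resulting monomials. *)
apply/eqP; rewrite -(eqn_pmul2l (ltn0Sn r)); apply/eqP.
have := congr1 (muln ((2 * m + 1) * d0)) hc.
have := congr1 (muln ((2 * m + 1) * c0)) hd1.
by have := congr1 (muln ((2 * r + 1) * c0)) hd2; lia.
Qed.

(** With [x = r + 1/2], twice [x - k] is [- (2 * (k - r.+1) + 1)]; this gives the sign and the
    factor [j = r.+1] of the product in the theorem. *)
Lemma gbinom_halfS (F : numFieldType) (r k : nat) :
  gbinom (r.+1%:R + 1 / 2 : F) k.+1 =
  - ((2 * r%:R + 3) / (2 * (k%:R - r.+1%:R) + 1)) *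
  gbinom (r%:R + 1 / 2) k.+1.
Proof.
have h := gbinom_shift (r%:R + 1 / 2 : F) k.
have o := odd_natr_neq0 F k r.+1; rewrite -[r.+1%:R]natr1 in o *.
have x0 : r%:R + 1 / 2 - k%:R != 0 :> F.
  apply: contraNneq o => x0; apply/eqP.
  by transitivity (- 2 * (r%:R + 1 / 2 - k%:R) : F); [field|rewrite x0 mulr0].
rewrite (addrAC r%:R 1); apply: (mulfI x0); rewrite h.
by field.
Qed.

Lemma gbinom_half (F : numFieldType) (k : nat) :
  gbinom (1 / 2 : F) k.+1 = (-1) ^+ k / 2 ^+ (2 * k + 1) * catalan F k.
Proof.
elim: k => [|k IH].
  by rewrite gbinomS /gbinom /catalan big_geq // fact0 bin0; field.
(* The new factor [(1/2 - k.+1) / k.+2] is [-1/4] times the Catalan ratio. *)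
rewrite gbinomS IH catalanS -[k.+1%:R]natr1.
rewrite (_ : 2 * k.+1 + 1 = (2 * k + 1).+2)%N ?(exprS _ k) ?exprS; last lia.
by field; rewrite -natrD expf_neq0 !pnatr_eq0.
Qed.

Theorem lemma1 (F : numFieldType) (r k : nat) :
  gbinom (r%:R + 1 / 2 : F) (k + 1) =
    ((-1) ^+ (k + r) * (2 * r%:R + 1) * (r + 1)`!%:R) /
    (2 ^+ (2 * k + r + 1) *
       \prod_(1 <= j < r.+1) (2 * (k%:R - j%:R) + 1)) *
    catalan F k * catalan F r
  /\
  ((r <= k)%N ->
   gbinom (r%:R + 1 / 2 : F) (k + 1) =
     (-1) ^+ (k + r) * ((2 * r%:R + 1) / 2 ^+ (2 * k + 1)) *
     ('C(k, r)%:R / 'C(2 * k, 2 * r)%:R) * catalan F k).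
Proof.
rewrite addn1; split.
  elim: r => [|r IH].
    rewrite !add0r gbinom_half big_geq // [catalan F 0]/catalan muln0 bin0.
    rewrite !addn0 add0n factS fact0.
    by field; rewrite expf_neq0 ?pnatr_eq0.
  have fS : (r.+1 + 1)`!%:R = r.+2%:R * (r + 1)`!%:R :> F.
    by rewrite !addn1 factS natrM.
  have s2 : (2 * k + r.+1 + 1 = (2 * k + r + 1).+1)%N by lia.
  (* The [r.+2] of the factorial cancels the denominator of the Catalan ratio, whose 2 absorbs the
     new power of 2. *)
  rewrite gbinom_halfS IH catalanS [\prod_(1 <= j < r.+2) _]big_nat_recr //= fS.
  rewrite (addnS k) s2 !(exprS _ (_ + _)).
  have p0 : \prod_(1 <= j < r.+1) (2 * (k%:R - j%:R) + 1) != 0 :> F.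
    by rewrite prodf_seq_neq0; apply/allP => j _; rewrite odd_natr_neq0.
  have := odd_natr_neq0 F k r.+1; rewrite -[r.+1%:R]natr1 => o.
  by field; rewrite p0 o expf_neq0 -?natrD !pnatr_eq0.
elim: r => [|r IH] rk.
  rewrite !muln0 !add0r gbinom_half !bin0 !addn0.
  by field; rewrite expf_neq0 ?pnatr_eq0.
have o : 2 * (k%:R - (r%:R + 1)) + 1 != 0 :> F by rewrite natr1 odd_natr_neq0.
have d0 : 'C(2 * k, 2 * r)%:R != 0 :> F.
  by rewrite pnatr_eq0 -lt0n bin_gt0; lia.
have d2 : 'C(2 * k, 2 * r.+1)%:R != 0 :> F.
  by rewrite pnatr_eq0 -lt0n bin_gt0; lia.
(* Once ['C(k, r.+1)] is eliminated, [field] can treat the remaining binomials as independent. *)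
have c1 : 'C(k, r.+1)%:R = (2 * r%:R + 1) * 'C(k, r)%:R * 'C(2 * k, 2 * r.+1)%:R
    / ((2 * (k%:R - (r%:R + 1)) + 1) * 'C(2 * k, 2 * r)%:R) :> F.
  have h : (2 * (k%:R - (r%:R + 1)) + 1) * ('C(k, r.+1)%:R * 'C(2 * k, 2 * r)%:R)
      = (2 * r%:R + 1) * ('C(k, r)%:R * 'C(2 * k, 2 * r.+1)%:R) :> F.
    rewrite natr1 -natrB // -!natrM !natr1 -!natrM -addn1 -[(2 * r).+1]addn1.
    by rewrite mul_bin_doubleS.
  by apply: (mulIf (mulf_neq0 o d0)); rewrite mulfVK ?mulf_neq0 // mulrCA h; ring.
rewrite gbinom_halfS (IH (ltnW rk)) c1 (addnS k) (exprS (-1)) -[r.+1%:R]natr1.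
by field; rewrite d0 d2 o expf_neq0 ?pnatr_eq0.
Qed.
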